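(* Let $\rho\in\mathbb R$, let $\kappa_{\mathbf a}:\mathbb H_\rho\times\mathbb H_\rho\to\mathbb C$ be a positive semi-definite Dirichlet series kernel with coefficient matrix $\mathbf a=(a_{m,n})$, let $\mathscr H_{\mathbf a}$ be the associated reproducing kernel Hilbert space, and let $A_{n,\mathbf a}$, $n\ge1$, be the analytic symbols of $\mathbf a$. Then: (i) $\kappa_{\mathbf a}(s,u)=\sum_{n=1}^\infty A_{n,\mathbf a}(s)n^{-\bar u}$ for all $s,u\in\mathbb H_\rho$; (ii) every $f\in\mathscr H_{\mathbf a}$ is a Dirichlet series given by $f(s)=\sum_{n=1}^\infty\langle f,A_{n,\mathbf a}\rangle_{\mathscr H_{\mathbf a}}n^{-s}$, $s\in\mathbb H_\rho$; (iii) $\{A_{n,\mathbf a}\}_{n\ge1}$ is a total subset of $\mathscr H_{\mathbf a}$.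
   Context: $\mathbb H_\rho=\{s\in\mathbb C:\Re(s)>\rho\}$. A double Dirichlet series $\sum c_{m,n}m^{-s}n^{-u}$ is regularly convergent at $(s_0,u_0)$ if it converges there and, for all $m,n\ge1$, $\sum_m c_{m,n}m^{-s_0}$ and $\sum_n c_{m,n}n^{-u_0}$ converge. $\kappa_{\mathbf a}(s,u)=\sum_{m,n\ge1}a_{m,n}m^{-s}n^{-\bar u}$ is a Dirichlet series kernel on $\mathbb H_\rho$ if $(s,u)\mapsto\kappa_{\mathbf a}(s,\bar u)$ is regularly convergent on $\mathbb H_\rho\times\mathbb H_\rho$. Positive semi-definite means every finite matrix $(\kappa_{\mathbf a}(s_i,s_j))$ is positive semi-definite. $\mathscr H_{\mathbf a}$ is the Hilbert space of functions on $\mathbb H_\rho$ with $\kappa_{\mathbf a}(\cdot,t)\in\mathscr H_{\mathbf a}$ and $\langle f,\kappa_{\mathbf a}(\cdot,t)\rangle=f(t)$ for all $t$. Analytic symbols: $A_{n,\mathbf a}(s)=\sum_{m\ge1}a_{m,n}m^{-s}$; these belong to $\mathscr H_{\mathbf a}$. A subset is total if its closed linear span is the whole space. *)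

(* Defs.v *)
From HB Require Import structures.
From mathcomp Require Import all_boot all_order all_algebra.
From mathcomp Require Import all_classical all_reals all_analysis.
From mathcomp Require Import complex.
Import Order.TTheory GRing.Theory Num.Theory.

Set Implicit Arguments.
Unset Strict Implicit.
Unset Printing Implicit Defensive.

Local Open Scope ring_scope.
Local Open Scope classical_set_scope.
Local Open Scope complex_scope.

Section DirichletKernels.
Variable R : realType.
Local Notation C := R[i].

(* n^{-s} = exp(-s log n) = n^{-Re s} (cos(Im s log n) - i sin(Im s log n)),
   used for n >= 1. *)
Definition npow (n : nat) (s : C) : C :=
  let ln_n : R := ln (n%:R : R) in
  let r : R := expR (- (complex.Re s) * ln_n) in
  let th : R := complex.Im s * ln_n in
  Complex (r * cos th) (- (r * sin th)).

Definition Hplane (rho : R) := {s : C | rho < complex.Re s}.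

Definition psum (u : nat -> C) (N : nat) : C := \sum_(1 <= k < N.+1) u k.

Definition series_to (u : nat -> C) (L : C) : Prop :=
  forall e : R, 0 < e -> exists N0 : nat, forall N : nat, (N0 <= N)%N ->
    `| psum u N - L | < e%:C.

Definition series_cvg (u : nat -> C) : Prop := exists L, series_to u L.

Definition dpsum (c : nat -> nat -> C) (M N : nat) : C :=
  \sum_(1 <= m < M.+1) \sum_(1 <= n < N.+1) c m n.

Definition dseries_to (c : nat -> nat -> C) (L : C) : Prop :=
  forall e : R, 0 < e -> exists N0 : nat, forall M N : nat,
    (N0 <= M)%N -> (N0 <= N)%N -> `| dpsum c M N - L | < e%:C.

Definition reg_cvg (c : nat -> nat -> C) (s0 u0 : C) : Prop :=
  [/\ exists L, dseries_to (fun m n => c m n * npow m s0 * npow n u0) L,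
      forall n : nat, (1 <= n)%N -> series_cvg (fun m => c m n * npow m s0)
    & forall m : nat, (1 <= m)%N -> series_cvg (fun n => c m n * npow n u0)].

(* kappa_a is a Dirichlet series kernel on H_rho: (s,u) |-> kappa_a(s, conj u)
   = sum a_{m,n} m^{-s} n^{-u} is regularly convergent on H_rho x H_rho. *)
Definition is_DS_kernel (rho : R) (a : nat -> nat -> C) : Prop :=
  forall s u : Hplane rho, reg_cvg a (val s) (val u).

Definition is_kernel_of (rho : R) (a : nat -> nat -> C)
    (K : Hplane rho -> Hplane rho -> C) : Prop :=
  forall s u : Hplane rho,
    dseries_to (fun m n => a m n * npow m (val s) * npow n (conjc (val u)))
               (K s u).

Definition psd_kernel (X : Type) (K : X -> X -> C) : Prop :=
  forall (k : nat) (x : 'I_k -> X) (c : 'I_k -> C),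
    0 <= \sum_(i < k) \sum_(j < k) conjc (c i) * c j * K (x i) (x j).

(* Analytic symbols A_{n,a}(s) = sum_{m >= 1} a_{m,n} m^{-s}
   (the value of the convergent series; 0 if it does not converge). *)
Definition symb (a : nat -> nat -> C) (n : nat) (s : C) : C :=
  xget 0 [set L | series_to (fun m => a m n * npow m s) L].

Definition Asym (rho : R) (a : nat -> nat -> C) (n : nat) : Hplane rho -> C :=
  fun s => symb a n (val s).

Record RKHS (X : Type) (K : X -> X -> C) := {
  hmem : set (X -> C);
  hip : (X -> C) -> (X -> C) -> C;
  hmem0 : hmem (fun _ => 0);
  hmemD : forall f g, hmem f -> hmem g -> hmem (fun x => f x + g x);
  hmemZ : forall (c : C) f, hmem f -> hmem (fun x => c * f x);
  hipDl : forall f g h, hmem f -> hmem g -> hmem h ->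
    hip (fun x => f x + g x) h = hip f h + hip g h;
  hipZl : forall (c : C) f g, hmem f -> hmem g ->
    hip (fun x => c * f x) g = c * hip f g;
  hipC : forall f g, hmem f -> hmem g -> hip g f = conjc (hip f g);
  hip_ge0 : forall f, hmem f -> 0 <= hip f f;
  hip_eq0 : forall f, hmem f -> hip f f = 0 -> f = (fun _ => 0);
  hcomplete : forall u : nat -> X -> C, (forall n, hmem (u n)) ->
    (forall e : R, 0 < e -> exists N0 : nat, forall m n : nat,
       (N0 <= m)%N -> (N0 <= n)%N ->
       sqrtC (hip (fun x => u m x - u n x) (fun x => u m x - u n x)) < e%:C) ->
    exists g, hmem g /\
      (forall e : R, 0 < e -> exists N0 : nat, forall n : nat, (N0 <= n)%N ->
       sqrtC (hip (fun x => u n x - g x) (fun x => u n x - g x)) < e%:C);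
  hker_mem : forall t, hmem (fun x => K x t);
  hrepro : forall f t, hmem f -> hip f (fun x => K x t) = f t
}.

Definition hnorm (X : Type) (K : X -> X -> C) (H : RKHS K) (f : X -> C) : C :=
  sqrtC (hip H f f).

Definition total_in (X : Type) (K : X -> X -> C) (H : RKHS K)
    (S : nat -> X -> C) : Prop :=
  (forall n : nat, (1 <= n)%N -> hmem H (S n)) /\
  forall f, hmem H f -> forall e : R, 0 < e ->
    exists (N : nat) (c : nat -> C),
      hnorm H (fun x => f x - \sum_(1 <= n < N.+1) c n * S n x) < e%:C.

End DirichletKernels.

(* Main.v *)
(**
  The point is that each symbol A_n lies in H_a, with <A_l, A_k> = a_{k,l}.
  On integer points s = N far to the right the kernel function is
  kappa(., N) = sum_k A_k k^{-N}, dominated by its first term, so by induction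
  on n the functions
      B_N = n^N (kappa(., N) - sum_{k < n} k^{-N} A_k)
  converge pointwise to A_n.  Their Gram matrix <B_M, B_N> is again such a
  rescaled Dirichlet tail, in both variables, and tends to a_{n,n}; hence B_N is
  Cauchy and A_n belongs to H_a.  In the same way <f, A_n> = lim <f, B_N> is
  the n-th coefficient of every f that has a Dirichlet expansion at the integers.

  Expanding the square with <A_l, A_k> = a_{k,l} shows that the partial sums of
  sum_n conj(n^{-s}) A_n converge in norm to kappa(., s), although the double
  series is only conditionally convergent; pairing with f gives (ii).  By (ii) a
  function orthogonal to all A_n vanishes, and (iii) follows from the
  minimal-distance argument.
*)
Require Import Defs.
From HB Require Import structures.
From mathcomp Require Import all_boot all_order all_algebra.
From mathcomp Require Import all_classical all_reals all_analysis.
From mathcomp Require Import complex.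
From mathcomp Require Import ring lra.
Import Order.TTheory GRing.Theory Num.Theory.
Import numFieldNormedType.Exports.
Local Open Scope ring_scope.
Local Open Scope complex_scope.

Set Implicit Arguments.
Unset Strict Implicit.
Unset Printing Implicit Defensive.

(** * Limits and series of complex numbers *)

Section Modulus.
Variable R : realType.
Local Notation C := R[i].
Implicit Types x y : C.

Definition cabs (x : C) : R := complex.Re `|x|.

Lemma cabsE x : `|x| = (cabs x)%:C.
Proof. by rewrite /cabs normc_def. Qed.

Lemma cabs_ge0 x : 0 <= cabs x.
Proof. by rewrite -lecR -cabsE normr_ge0. Qed.

Lemma cabs0 : cabs 0 = 0.
Proof. by apply: complexI; rewrite -cabsE normr0. Qed.

Lemma cabs_eq0 x : cabs x = 0 -> x = 0.
Proof. by move=> x0; apply/eqP; rewrite -normr_eq0 cabsE x0. Qed.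

Lemma cabsN x : cabs (- x) = cabs x.
Proof. by rewrite /cabs normrN. Qed.

Lemma cabsM x y : cabs (x * y) = cabs x * cabs y.
Proof. by apply: complexI; rewrite -cabsE normrM !cabsE rmorphM. Qed.

Lemma cabsD x y : cabs (x + y) <= cabs x + cabs y.
Proof. by rewrite -lecR rmorphD /= -!cabsE ler_normD. Qed.

Lemma cabsB x y : cabs (x - y) <= cabs x + cabs y.
Proof. by rewrite -(cabsN y) cabsD. Qed.

Lemma cabs_distrC x y : cabs (x - y) = cabs (y - x).
Proof. by rewrite -cabsN opprB. Qed.

Lemma cabsJ x : cabs (conjc x) = cabs x.
Proof. by rewrite /cabs normcJ. Qed.

Lemma cabs_ge0E x : 0 <= x -> x = (cabs x)%:C.
Proof. by move=> x0; rewrite -cabsE ger0_norm. Qed.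

Lemma cabs_nat n : cabs n%:R = n%:R.
Proof. by apply: complexI; rewrite -cabsE rmorph_nat normr_nat. Qed.

Lemma cabsX x n : cabs (x ^+ n) = cabs x ^+ n.
Proof. by apply: complexI; rewrite -cabsE normrX cabsE rmorphXn. Qed.

Lemma cabsV x : cabs x^-1 = (cabs x)^-1.
Proof. by apply: complexI; rewrite -cabsE normfV cabsE fmorphV. Qed.

Lemma sqrtC_lt (x : C) (e : R) : 0 <= x -> 0 < e ->
  (sqrtC x < e%:C) = (cabs x < e ^+ 2).
Proof.
move=> x0 e0; rewrite -ltcR -cabs_ge0E // rmorphXn /=.
have e0' : (0 : C) <= e%:C by rewrite lecR ltW.
by rewrite -[in LHS](sqrCK e0') ltr_sqrtC // nnegrE exprn_ge0.
Qed.

End Modulus.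

(** * Convergence of sequences, of series and of double series *)

Section Limits.
Variable R : realType.
Local Notation C := R[i].
Implicit Types (u v : nat -> C) (L c : C) (b : nat -> R).

(** Unfolds to [null_seq] of the real distances [cabs (u N - L)], so limit rules reduce to squeezing
    real sequences. *)
Definition clim u L := forall e : R, 0 < e ->
  exists N0 : nat, forall N, (N0 <= N)%N -> cabs (u N - L) < e.

Definition null_seq b := forall e : R, 0 < e ->
  exists N0 : nat, forall N, (N0 <= N)%N -> b N < e.

Lemma series_toE u L : series_to u L <-> clim (psum u) L.
Proof.
split=> h e /h [N0 hN]; exists N0 => N /hN; by rewrite cabsE ltcR.
Qed.

Lemma null_seq_le b b' : (forall n, b n <= b' n) -> null_seq b' -> null_seq b.
Proof.
move=> hb h e /h [N0 hN]; exists N0 => N /hN; exact: le_lt_trans.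
Qed.

Lemma null_seqD b b' : null_seq b -> null_seq b' -> null_seq (fun n => b n + b' n).
Proof.
move=> h h' e e0; have e2 : 0 < e / 2 by rewrite divr_gt0.
have [N hN] := h _ e2; have [N' hN'] := h' _ e2.
exists (maxn N N') => n; rewrite geq_max => /andP[/hN ? /hN' ?]; lra.
Qed.

Lemma null_seqMl b (c : R) : 0 <= c -> null_seq b -> null_seq (fun n => c * b n).
Proof.
move=> c0 h e e0; have c1 : 0 < c + 1 by lra.
have [N hN] := h _ (divr_gt0 e0 c1); exists N => n /hN.
rewrite ltr_pdivlMr // => hb.
have [b0|b0] := leP 0 (b n); nra.
Qed.

Lemma null_seq_shift b k : null_seq (fun n => b (n + k)%N) <-> null_seq b.
Proof.
split=> h e /h [N hN].
  exists (N + k)%N => n hn; have hk := leq_trans (leq_addl N k) hn.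
  by have := hN (n - k)%N; rewrite subnK //; apply; rewrite -(leq_add2r k) subnK.
by exists N => n hn; apply: hN; rewrite (leq_trans hn) ?leq_addr.
Qed.

Lemma null_seq_ge0 b (x : R) : (forall n, x <= b n) -> null_seq b -> x <= 0.
Proof.
move=> hx h; rewrite leNgt; apply/negP => /h [N /(_ N (leqnn _))].
by rewrite ltNge hx.
Qed.

Lemma null_seq_geometric (q : R) : 0 <= q < 1 -> null_seq (fun n => q ^+ n).
Proof.
move=> /andP[q0 q1] e e0.
have := @cvg_expr R q; rewrite ger0_norm // => /(_ q1).
move=> /cvgrPdist_lt/(_ _ e0)[N _ hN]; exists N => n /hN /=.
by rewrite sub0r normrN ger0_norm ?exprn_ge0.
Qed.

Lemma null_seq_harmonic : null_seq (fun n => n.+1%:R^-1 : R).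
Proof.
move=> e e0; have /cvgrPdist_lt/(_ _ e0)[N _ hN] := @cvg_harmonic R.
by exists N => n /hN /=; rewrite sub0r normrN ger0_norm // invr_ge0.
Qed.

Lemma null_seq_sqr (b : nat -> R) :
  (forall n, 0 <= b n) -> null_seq (fun n => b n ^+ 2) -> null_seq b.
Proof.
move=> b0 h e e0; have [N hN] := h _ (exprn_gt0 2 e0); exists N => n /hN.
by rewrite ltr_pXn2r // nnegrE ?b0 ?ltW.
Qed.

Lemma clim_unique u L (M : C) : clim u L -> clim u M -> L = M.
Proof.
move=> hL hM; apply/eqP; rewrite -subr_eq0; apply/eqP/cabs_eq0/eqP.
rewrite eq_le cabs_ge0 andbT; apply: null_seq_ge0 (null_seqD hL hM) => n /=.
by rewrite (cabs_distrC (u n) L) (le_trans _ (cabsD _ _)) // addrA subrK.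
Qed.

Lemma climD u v L (M : C) : clim u L -> clim v M -> clim (fun n => u n + v n) (L + M).
Proof.
move=> hu hv; apply: null_seq_le (null_seqD hu hv) => n /=.
by rewrite (le_trans _ (cabsD _ _)) // opprD addrACA.
Qed.

Lemma climMl u L c : clim u L -> clim (fun n => c * u n) (c * L).
Proof.
move=> hu; apply: null_seq_le (null_seqMl (cabs_ge0 c) hu) => n /=.
by rewrite -cabsM mulrBr.
Qed.

Lemma climB u v L (M : C) : clim u L -> clim v M -> clim (fun n => u n - v n) (L - M).
Proof.
move=> hu /(climMl (-1)); rewrite mulN1r => /(climD hu).
by under eq_fun do rewrite mulN1r.
Qed.

Lemma climJ u L : clim u L -> clim (fun n => conjc (u n)) (conjc L).
Proof.
by move=> hu; apply: null_seq_le hu => n; rewrite -rmorphB cabsJ.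
Qed.

Lemma clim_cst c : clim (fun=> c) c.
Proof. by move=> e e0; exists 0%N => N _; rewrite subrr cabs0. Qed.

Lemma clim_shift u L k : clim (fun n => u (n + k)%N) L <-> clim u L.
Proof. exact: (null_seq_shift (fun n => cabs (u n - L))). Qed.

Lemma clim_bound u L (b : R) : (forall n, cabs (u n) <= b) -> clim u L -> cabs L <= b.
Proof.
move=> hb hu; rewrite -subr_le0; apply: null_seq_ge0 hu => n.
have := cabsB (u n) (u n - L); rewrite opprB addrC subrK; have := hb n; lra.
Qed.

Lemma clim_eventually_bounded u L (b : R) :
  clim u L -> (exists N0 : nat, forall N, (N0 <= N)%N -> cabs (u N) <= b) -> cabs L <= b.
Proof.
move=> hu [N0 hN]; apply: (@clim_bound (fun n => u (n + N0)%N)); last exact/clim_shift.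
by move=> n; apply: hN; rewrite leq_addl.
Qed.

Lemma clim_bounded u L : clim u L -> exists b : R, forall n, cabs (u n) <= b.
Proof.
move=> /(_ 1 ltr01)[N0 hN].
exists (cabs L + 1 + \sum_(i < N0) cabs (u i)) => n.
have [h|h] := leqP N0 n.
  have := cabsD (u n - L) L; rewrite subrK; have := hN _ h.
  have : 0 <= \sum_(i < N0) cabs (u i) by apply: sumr_ge0 => *; exact: cabs_ge0.
  lra.
rewrite (bigD1 (Ordinal h)) //=.
have : 0 <= \sum_(i < N0 | i != Ordinal h) cabs (u i).
  by apply: sumr_ge0 => *; exact: cabs_ge0.
have := cabs_ge0 L; lra.
Qed.

Lemma psumS u N : psum u N.+1 = psum u N + u N.+1.
Proof. by rewrite /psum big_nat_recr. Qed.

Lemma psum0 u : psum u 0 = 0.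
Proof. by rewrite /psum big_geq. Qed.

Lemma eq_psum u v N : (forall k, (1 <= k <= N)%N -> u k = v k) -> psum u N = psum v N.
Proof. by move=> h; rewrite /psum; apply: eq_big_nat. Qed.

Lemma psumMl u c N : psum (fun k => c * u k) N = c * psum u N.
Proof. by rewrite /psum mulr_sumr. Qed.

Lemma psumD u v N : psum (fun k => u k + v k) N = psum u N + psum v N.
Proof. by rewrite /psum big_split. Qed.

Lemma psumB u v N : psum (fun k => u k - v k) N = psum u N - psum v N.
Proof. by rewrite /psum sumrB. Qed.

Lemma conjc_psum u N : conjc (psum u N) = psum (fun k => conjc (u k)) N.
Proof. by rewrite /psum rmorph_sum. Qed.

Lemma psum_exchange (c : nat -> nat -> C) (M N : nat) :
  psum (fun m => psum (c m) N) M = psum (fun n => psum (c^~ n) M) N.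
Proof. by rewrite /psum exchange_big. Qed.

Lemma clim_psum (u : nat -> nat -> C) (L : nat -> C) N :
  (forall k, (1 <= k <= N)%N -> clim (u k) (L k)) ->
  clim (fun i => psum (u^~ i) N) (psum L N).
Proof.
elim: N => [|N IH] h.
  rewrite psum0; under eq_fun do rewrite psum0; exact: clim_cst.
rewrite psumS; under eq_fun do rewrite psumS.
apply: climD; last by apply: h; rewrite leqnn.
by apply: IH => k /andP[k1 kN]; apply: h; rewrite k1 leqW.
Qed.

Lemma series_to_terms_bounded u L : series_to u L ->
  exists2 b : R, 0 <= b & forall n, (1 <= n)%N -> cabs (u n) <= b.
Proof.
move=> /series_toE /clim_bounded [b hb]; exists (b + b).
  by have := hb 0%N; have := cabs_ge0 (psum u 0); lra.
case=> // n _; have -> : u n.+1 = psum u n.+1 - psum u n by rewrite psumS addrC addKr.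
by apply: le_trans (cabsB _ _) _; apply: lerD.
Qed.

Lemma eq_series_to u v L : (forall k, (1 <= k)%N -> u k = v k) ->
  series_to u L -> series_to v L.
Proof.
move=> huv /series_toE h; apply/series_toE; rewrite (_ : psum v = psum u) //.
by apply/funext => N; apply: eq_psum => k /andP[/huv].
Qed.

Lemma series_toMl u L c : series_to u L -> series_to (fun k => c * u k) (c * L).
Proof.
move=> /series_toE/(climMl c) h; apply/series_toE.
by rewrite (_ : psum _ = fun n => c * psum u n) //; apply/funext => N; rewrite psumMl.
Qed.

Lemma series_toB u v L (M : C) : series_to u L -> series_to v M ->
  series_to (fun k => u k - v k) (L - M).
Proof.
move=> /series_toE hu /series_toE /(climB hu) h; apply/series_toE.
by rewrite (_ : psum _ = fun n => psum u n - psum v n) //; apply/funext => N; rewrite psumB.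
Qed.

Lemma series_to_psum (u : nat -> nat -> C) (L : nat -> C) N :
  (forall k, (1 <= k <= N)%N -> series_to (u k) (L k)) ->
  series_to (fun m => psum (u^~ m) N) (psum L N).
Proof.
move=> h; apply/series_toE.
rewrite (_ : psum _ = fun M => psum (fun k => psum (u k) M) N); last first.
  by apply/funext => M; rewrite psum_exchange.
by apply: (@clim_psum (fun k M => psum (u k) M)) => k /h /series_toE.
Qed.

Lemma dpsumE (c : nat -> nat -> C) (M N : nat) : dpsum c M N = psum (fun m => psum (c m) N) M.
Proof. by []. Qed.

Lemma dpsum_tr (c : nat -> nat -> C) (M N : nat) : dpsum c M N = dpsum (fun n m => c m n) N M.
Proof. by rewrite /dpsum exchange_big. Qed.

Lemma dseries_to_tr (c : nat -> nat -> C) L :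
  dseries_to c L -> dseries_to (fun n m => c m n) L.
Proof.
by move=> h e /h [N0 hN]; exists N0 => M N hM hN'; rewrite dpsum_tr; apply: hN.
Qed.

(** For fixed large [M], the rectangular sums stay close to [L] for all large [N], and their limit
    in [N] is the partial sum of the row sums. *)
Lemma dseries_to_iterated (c : nat -> nat -> C) (S : nat -> C) L :
  dseries_to c L -> (forall m, (1 <= m)%N -> series_to (c m) (S m)) ->
  series_to S L.
Proof.
move=> hc hS; apply/series_toE => e e0.
have [N0 hN] := hc _ (divr_gt0 e0 (ltr0n _ 2)); exists N0 => M hM.
(* Passing to the limit in [N] keeps only a weak inequality, hence the margin [e / 2]. *)
apply: (@le_lt_trans _ _ (e / 2)); last by lra.
apply: (@clim_eventually_bounded (fun N => dpsum c M N - L)).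
  apply: climB; last exact: clim_cst.
  by apply: (@clim_psum (fun m N => psum (c m) N)) => k /andP[/hS /series_toE].
exists N0 => N hN'; rewrite ltW // -ltcR -cabsE; exact: hN.
Qed.

End Limits.

(** * Geometry of a reproducing kernel Hilbert space *)

Section HilbertSpace.
Variables (R : realType) (X : Type) (K : X -> X -> R[i]) (H : RKHS K).
Local Notation C := R[i].
Local Notation hm := (hmem H).
Local Notation "<< f , g >>" := (hip H f g).
Implicit Types (f g h : X -> C) (c : C).

Lemma hmemB f g : hm f -> hm g -> hm (fun x => f x - g x).
Proof.
move=> hf hg; rewrite (_ : (fun x => _) = fun x => f x + (-1) * g x).
  by apply: hmemD => //; apply: hmemZ.
by apply/funext => x; rewrite mulN1r.
Qed.

Lemma hip0l g : hm g -> << fun=> 0, g >> = 0.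
Proof.
move=> hg; rewrite -[RHS](mul0r << fun=> 0, g >>) -(hipZl 0 (hmem0 H) hg).
by under [in RHS]eq_fun do rewrite mulr0.
Qed.

Lemma hip0r f : hm f -> << f, fun=> 0 >> = 0.
Proof. by move=> hf; rewrite (hipC (hmem0 H) hf) hip0l // rmorph0. Qed.

Lemma hipBl f g h : hm f -> hm g -> hm h ->
  << fun x => f x - g x, h >> = << f, h >> - << g, h >>.
Proof.
move=> hf hg hh; rewrite (_ : (fun x => _) = fun x => f x + (-1) * g x).
  by rewrite hipDl ?hipZl ?mulN1r //; apply: hmemZ.
by apply/funext => x; rewrite mulN1r.
Qed.

Lemma hipBr f g h : hm f -> hm g -> hm h ->
  << h, fun x => f x - g x >> = << h, f >> - << h, g >>.
Proof.
move=> hf hg hh; rewrite (hipC (hmemB hf hg) hh) hipBl // rmorphB /=.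
by rewrite -(hipC hf hh) -(hipC hg hh).
Qed.

Lemma hipZr c f g : hm f -> hm g -> << f, fun x => c * g x >> = conjc c * << f, g >>.
Proof.
by move=> hf hg; rewrite (hipC (hmemZ c hg) hf) hipZl // rmorphM /= -(hipC hg hf).
Qed.

Lemma hmem_psum (F : nat -> X -> C) (a : nat -> C) N :
  (forall k, (1 <= k <= N)%N -> hm (F k)) -> hm (fun x => psum (fun k => a k * F k x) N).
Proof.
elim: N => [|N IH] hF.
  by under eq_fun do rewrite psum0; exact: hmem0.
under eq_fun do rewrite psumS; apply: hmemD.
  by apply: IH => k /andP[k1 kN]; apply: hF; rewrite k1 leqW.
by apply: hmemZ; apply: hF; rewrite leqnn.
Qed.

Lemma hip_psuml (F : nat -> X -> C) (a : nat -> C) N g :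
  (forall k, (1 <= k <= N)%N -> hm (F k)) -> hm g ->
  << fun x => psum (fun k => a k * F k x) N, g >> = psum (fun k => a k * << F k, g >>) N.
Proof.
elim: N => [|N IH] hF hg.
  by under eq_fun do rewrite psum0; rewrite hip0l // psum0.
have hF' k : (1 <= k <= N)%N -> hm (F k).
  by move=> /andP[k1 kN]; apply: hF; rewrite k1 leqW.
have hN : hm (F N.+1) by apply: hF; rewrite leqnn.
under eq_fun do rewrite psumS.
by rewrite hipDl ?hipZl ?IH ?psumS //; [exact: hmem_psum | exact: hmemZ].
Qed.

Lemma hip_psumr (F : nat -> X -> C) (a : nat -> C) N g :
  (forall k, (1 <= k <= N)%N -> hm (F k)) -> hm g ->
  << g, fun x => psum (fun k => a k * F k x) N >> =
  psum (fun k => conjc (a k) * << g, F k >>) N.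
Proof.
move=> hF hg; rewrite (hipC (hmem_psum a hF) hg) hip_psuml // conjc_psum.
by apply: eq_psum => k kN; rewrite rmorphM /= -(hipC (hF _ kN) hg).
Qed.

Lemma kernel_hermitian s t : K s t = conjc (K t s).
Proof.
rewrite -(hrepro s (hker_mem H t)) -(hrepro t (hker_mem H s)).
by rewrite -(hipC (hker_mem H s) (hker_mem H t)).
Qed.

(** The squared norm as a real number, so that real order arguments and infima apply. *)
Definition hsq f : R := cabs << f, f >>.

Lemma hsqE f : hm f -> << f, f >> = (hsq f)%:C.
Proof. by move=> hf; apply/cabs_ge0E/hip_ge0. Qed.

Lemma hsq_ge0 f : 0 <= hsq f.
Proof. exact: cabs_ge0. Qed.

Lemma hsq_eq0 f : hm f -> hsq f = 0 -> f = fun=> 0.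
Proof. by move=> hf hf0; apply: (hip_eq0 hf); rewrite (hsqE hf) hf0. Qed.

Lemma hsqZ c f : hm f -> hsq (fun x => c * f x) = cabs c ^+ 2 * hsq f.
Proof.
move=> hf; rewrite /hsq hipZl ?hipZr ?cabsM ?cabsJ //; last exact: hmemZ.
by rewrite mulrA.
Qed.

Lemma hipBB f g : hm f -> hm g ->
  << fun x => f x - g x, fun x => f x - g x >> =
  << f, f >> - << f, g >> - (<< g, f >> - << g, g >>).
Proof.
move=> hf hg; have hB := hmemB hf hg.
by rewrite hipBl // !hipBr // opprB.
Qed.

Lemma cauchy_schwarz f g : hm f -> hm g -> cabs << f, g >> ^+ 2 <= hsq f * hsq g.
Proof.
move=> hf hg; have [g0|g0] := eqVneq (hsq g) 0.
  by rewrite (hsq_eq0 hg g0) hip0r // cabs0 expr0n /= mulr_ge0 ?hsq_ge0.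
have gp : 0 < hsq g by rewrite lt_neqAle eq_sym g0 hsq_ge0.
set p := << f, g >>.
(* Positivity is applied to [hsq g * f - p * g], the residual of projecting [f] on [g] cleared of
   its denominator. *)
have hG := hmemZ (hsq g)%:C hf; have hp := hmemZ p hg.
have := hip_ge0 (hmemB hG hp); rewrite hipBB // !hipZl // !hipZr //.
rewrite (hsqE hf) (hsqE hg) (hipC hf hg) -/p conjc_real.
have pp : p * conjc p = (cabs p ^+ 2)%:C.
  by rewrite -sqr_normc cabsE rmorphXn.
have -> : (hsq g)%:C * ((hsq g)%:C * (hsq f)%:C) - (hsq g)%:C * (conjc p * p) -
   (p * ((hsq g)%:C * conjc p) - p * (conjc p * (hsq g)%:C)) =
   (hsq g * (hsq g * hsq f - cabs p ^+ 2))%:C.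
  by rewrite rmorphM rmorphB rmorphM /= -pp; ring.
rewrite lecR pmulr_rge0 // subr_ge0 mulrC; exact: id.
Qed.

Lemma parallelogram f g : hm f -> hm g ->
  hsq (fun x => f x - g x) + hsq (fun x => f x + g x) = 2 * hsq f + 2 * hsq g.
Proof.
move=> hf hg; apply: complexI; rewrite !(rmorphD, rmorphM) /=.
have hD := hmemD hf hg; have hB := hmemB hf hg.
rewrite -!hsqE // hipBB // hipDl // (hipC hD hf) (hipC hD hg) !hipDl // !rmorphD /=.
by rewrite -(hipC hf hf) -(hipC hg hf) -(hipC hf hg) -(hipC hg hg); ring.
Qed.

Definition hlim (u : nat -> X -> C) f := null_seq (fun n => hsq (fun x => u n x - f x)).

Lemma hcauchy_cvg (u : nat -> X -> C) : (forall n, hm (u n)) ->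
  (forall e : R, 0 < e -> exists N0 : nat, forall m n, (N0 <= m)%N -> (N0 <= n)%N ->
     hsq (fun x => u m x - u n x) < e) ->
  exists2 g, hm g & hlim u g.
Proof.
move=> hu hc; have [|g [hg hlg]] := hcomplete hu.
  move=> e e0; have [N0 hN] := hc _ (exprn_gt0 2 e0); exists N0 => m n hm' hn.
  by rewrite sqrtC_lt //; [exact: hN | apply/hip_ge0/hmemB].
exists g => // e e0; have s0 : 0 < Num.sqrt e by rewrite sqrtr_gt0.
have [N0 hN] := hlg _ s0; exists N0 => n /hN; rewrite sqrtC_lt //.
  by rewrite sqr_sqrtr // ltW.
exact/hip_ge0/hmemB.
Qed.

Lemma hlim_hip (u : nat -> X -> C) f g : (forall n, hm (u n)) -> hm f -> hm g ->
  hlim u f -> clim (fun n => << u n, g >>) << f, g >>.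
Proof.
move=> hu hf hg hl e e0.
have [N0 hN] := null_seqMl (hsq_ge0 g) hl (exprn_gt0 2 e0).
exists N0 => n /hN h; rewrite -hipBl //.
rewrite -(@ltr_pXn2r _ 2) ?nnegrE ?cabs_ge0 ?ltW //.
by apply: le_lt_trans h; rewrite mulrC cauchy_schwarz //; exact: hmemB.
Qed.

Lemma hlim_hipr (u : nat -> X -> C) f g : (forall n, hm (u n)) -> hm f -> hm g ->
  hlim u f -> clim (fun n => << g, u n >>) << g, f >>.
Proof.
move=> hu hf hg hl; rewrite (hipC hf hg).
have := climJ (hlim_hip hu hf hg hl).
by under eq_fun do rewrite -(hipC (hu _) hg).
Qed.

(** Evaluation at [t] is pairing with a kernel function; this later identifies abstract norm
    limits. *)
Lemma hlim_eval (u : nat -> X -> C) f t : (forall n, hm (u n)) -> hm f ->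
  hlim u f -> clim (fun n => u n t) (f t).
Proof.
move=> hu hf hl; have := hlim_hip hu hf (hker_mem H t) hl.
rewrite hrepro //; by under eq_fun do rewrite hrepro //.
Qed.

End HilbertSpace.

(** * Density of a subspace with trivial orthogonal complement *)

Section Density.
Variables (R : realType) (X : Type) (K : X -> X -> R[i]) (H : RKHS K).
Local Notation C := R[i].
Local Notation hm := (hmem H).
Local Notation "<< f , g >>" := (hip H f g).
Local Open Scope classical_set_scope.

(** The residuals of a minimising sequence in [V] are Cauchy by the parallelogram law. Their limit
    is orthogonal to [V], hence zero, so the sequence itself approximates [f]. *)
Lemma dense_of_orthogonal_trivial (V : set (X -> C)) :
  (forall g, V g -> hm g) -> V (fun=> 0) ->
  (forall g h, V g -> V h -> V (fun x => g x + h x)) ->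
  (forall c g, V g -> V (fun x => c * g x)) ->
  (forall h, hm h -> (forall g, V g -> << h, g >> = 0) -> h = fun=> 0) ->
  forall f (e : R), hm f -> 0 < e -> exists2 g, V g & hsq H (fun x => f x - g x) < e.
Proof.
move=> Vm V0 VD VZ Vorth f e hf e0.
pose D := [set hsq H (fun x => f x - g x) | g in V].
have Dinf : has_inf D.
  split; first by exists (hsq H (fun x => f x - 0)), (fun=> 0).
  by exists 0 => _ [g _ <-]; exact: hsq_ge0.
have hd g : V g -> inf D <= hsq H (fun x => f x - g x).
  by move=> Vg; apply: ge_inf; [case: Dinf | exists g].
have [u hu] : {u : nat -> X -> C & forall n,
    V (u n) /\ hsq H (fun x => f x - u n x) < inf D + n.+1%:R^-1}.
  apply: (@choice _ _ (fun n g => V g /\ hsq H (fun x => f x - g x) < inf D + n.+1%:R^-1)) => n.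
  have [|_ [g Vg <-] ?] := inf_adherent (_ : 0 < n.+1%:R^-1 :> R) Dinf.
    by rewrite invr_gt0.
  by exists g.
pose r n x := f x - u n x.
have hr n : hm (r n) by apply: hmemB => //; apply/Vm; case: (hu n).
have rlt n : hsq H (r n) < inf D + n.+1%:R^-1 by case: (hu n).
have rcauchy m n : hsq H (fun x => r m x - r n x) <= 2 * m.+1%:R^-1 + 2 * n.+1%:R^-1.
  (* The midpoint lies in [V], so its residual [w], half of [r m + r n], has squared norm at least
     [inf D]. *)
  have Vmid : V (fun x => 2^-1 * (u m x + u n x)).
    by apply: VZ; apply: VD; [case: (hu m) | case: (hu n)].
  have := hd _ Vmid; set w := fun x => _ => hw.
  have hmw : hm w by apply: hmemB => //; exact: Vm.
  have := parallelogram (hr m) (hr n).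
  have -> : (fun x => r m x + r n x) = fun x => 2 * w x.
    by apply/funext => x; rewrite /w /r; field.
  rewrite hsqZ // cabs_nat => hpar.
  have lin (a b c d x y z : R) : a < d + x -> b < d + y ->
    z + 2 ^+ 2 * c = 2 * b + 2 * a -> d <= c -> z <= 2 * y + 2 * x by lra.
  exact: lin (rlt n) (rlt m) hpar hw.
have [| h hh hlh] := hcauchy_cvg hr.
  move=> d d0; have d4 : 0 < d / 4 by lra.
  have [N0 hN] := null_seq_harmonic d4; exists N0 => m n /hN Hm /hN Hn.
  apply: le_lt_trans (rcauchy m n) _.
  by move: m.+1%:R^-1 n.+1%:R^-1 Hm Hn => a b; lra.
have h0 : h = fun=> 0.
  apply: Vorth => // g Vg; have hg := Vm _ Vg.
  apply: clim_unique (hlim_hip hr hh hg hlh) _.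
  set G := hsq H g; have G0 : 0 <= G by exact: hsq_ge0.
  have G1 : 0 < G + 1 by lra.
  apply: null_seq_sqr; first by move=> n; exact: cabs_ge0.
  apply: null_seq_le (null_seqMl (ltW G1) (@null_seq_harmonic R)) => n /=.
  (* Minimality at [u n] perturbed by [l p g], where [l = 1 / (|g|^2 + 1)]. *)
  rewrite subr0; set p := << r n, g >>; set l := (G + 1)^-1.
  have Vt : V (fun x => u n x + (l%:C * p) * g x).
    by apply: VD; [case: (hu n) | exact: VZ].
  have := hd _ Vt.
  have -> : (fun x => f x - (u n x + l%:C * p * g x)) = fun x => r n x - l%:C * p * g x.
    by apply/funext => x; rewrite /r opprD addrA.
  have hpg := hmemZ (l%:C * p) hg.
  have -> : hsq H (fun x => r n x - l%:C * p * g x) =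
      hsq H (r n) - 2 * l * cabs p ^+ 2 + l ^+ 2 * cabs p ^+ 2 * G.
    apply: complexI; rewrite -(hsqE (hmemB (hr n) hpg)) hipBB //.
    rewrite !hipZr // !hipZl // (hsqE (hr n)) (hsqE hg) (hipC (hr n) hg) -/p.
    have -> : conjc (l%:C * p) = l%:C * conjc p by rewrite rmorphM; congr (_ * _); exact: conjc_real.
    have -> : (hsq H (r n) - 2 * l * cabs p ^+ 2 + l ^+ 2 * cabs p ^+ 2 * G)%:C =
      (hsq H (r n))%:C - 2 * l%:C * (cabs p)%:C ^+ 2 + l%:C ^+ 2 * (cabs p)%:C ^+ 2 * G%:C.
      by rewrite !(rmorphD, rmorphN, rmorphM, rmorphXn, rmorph1).
    by rewrite -cabsE sqr_normc /G; ring.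
  have lG : l * (G + 1) = 1 by rewrite mulVf // gt_eqF.
  have l0 : 0 < l by rewrite invr_gt0.
  move=> hle; have := rlt n; set s := hsq H (r n) in hle * => hs.
  (* Minimality bounds [l * |p|^2 * (2 - l * G)] by [1 / (n + 1)], and [l * G = 1 - l] makes the
     last factor at least 1. *)
  have hq : l * cabs p ^+ 2 <= n.+1%:R^-1.
    have -> : l * cabs p ^+ 2 = 2 * l * cabs p ^+ 2 - l * (l * (G + 1)) * cabs p ^+ 2.
      by rewrite lG; ring.
    have : 0 <= l ^+ 2 * cabs p ^+ 2 by rewrite -exprMn sqr_ge0.
    by move: n.+1%:R^-1 hs => h' hs; lra.
  by rewrite -ler_pdivrMl.
have [N0 hN] := hlh _ e0; exists (u N0); first by case: (hu N0).
by have := hN _ (leqnn N0); rewrite h0; under eq_fun do rewrite subr0.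
Qed.

End Density.

(** * Extracting Dirichlet coefficients along the integers *)

Section DirichletTail.
Variable R : realType.
Local Notation C := R[i].
Implicit Types (y : nat -> C) (F : C).

(* The exponent j + 2, rather than j, makes every bounded coefficient sequence
   summable against [wt j]. *)
Definition wt (j k : nat) : C := k%:R ^- j.+2.

(** If [F] is the full series of [wt j k * y k], this is [y n.+1] plus the terms [y k] with
    [k > n.+1], damped by [(n.+1 / k)^(j+2)]. *)
Definition tailn (n j : nat) (F : C) (y : nat -> C) : C :=
  n.+1%:R ^+ j.+2 * (F - psum (fun k => wt j k * y k) n).

(** The largest of the damping quotients [n.+1 / k] with [k > n.+1]. *)
Definition ratio (n : nat) : R := n.+1%:R / n.+2%:R.

Lemma ratio_itv n : 0 <= ratio n < 1.
Proof. by rewrite divr_ge0 //= ltr_pdivrMr // mul1r ltr_nat. Qed.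

Lemma cabs_wt j k : cabs (wt j k) = k%:R ^- j.+2.
Proof. by rewrite cabsV cabsX cabs_nat. Qed.

Lemma conjc_wt j k : conjc (wt j k) = wt j k.
Proof. by rewrite /wt fmorphV rmorphXn /= conjc_nat. Qed.

(** Of the [j + 2] damping factors, [j] are bounded by [ratio n]; the other two leave
    [1 / (P + 1)^2 <= 1 / P - 1 / (P + 1)], which telescopes. *)
Lemma tailn_psum_bound n j c y i : (forall k, (1 <= k)%N -> cabs (y k) <= c) ->
  cabs (tailn n j (psum (fun k => wt j k * y k) (n.+1 + i)) y - y n.+1) <=
  c * (n.+1%:R ^+ 2 * ratio n ^+ j * (n.+1%:R^-1 - (n.+1 + i)%:R^-1)).
Proof.
move=> hy; elim: i => [|i IH].
  rewrite addn0 subrr !mulr0 /tailn psumS [psum _ n + _]addrC addrK mulrA mulfV; last first.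
    by rewrite expf_neq0 // pnatr_eq0.
  by rewrite mul1r subrr cabs0.
set P := (n.+1 + i)%N in IH *; rewrite addnS -/P psumS.
have -> : tailn n j (psum (fun k => wt j k * y k) P + wt j P.+1 * y P.+1) y - y n.+1 =
   (tailn n j (psum (fun k => wt j k * y k) P) y - y n.+1) +
   n.+1%:R ^+ j.+2 * wt j P.+1 * y P.+1 by rewrite /tailn; ring.
apply: le_trans (cabsD _ _) _.
have c0 : 0 <= c by apply: le_trans (hy 1%N _); rewrite ?cabs_ge0.
have P0 : (0 < P)%N by rewrite /P addSn.
have PR : 0 < P%:R :> R by rewrite ltr0n.
set q := ratio n in IH *.
suff hs : cabs (n.+1%:R ^+ j.+2 * wt j P.+1 * y P.+1) <=
   c * (n.+1%:R ^+ 2 * q ^+ j * (P%:R^-1 - P.+1%:R^-1)).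
  apply: le_trans (lerD IH hs) _; rewrite -mulrDr le_eqVlt; apply/orP; left.
  by apply/eqP; rewrite -mulrDr; congr (_ * (_ * _)); rewrite addrA subrK.
rewrite cabsM mulrC; apply: ler_pM; rewrite ?cabs_ge0 ?hy //.
rewrite cabsM cabs_wt cabsX cabs_nat -expr_div_n -addn2 exprD.
rewrite mulrC -[leRHS]mulrA [q ^+ j * _]mulrC mulrA.
apply: ler_pM; rewrite ?exprn_ge0 ?divr_ge0 //.
  rewrite expr_div_n; apply: ler_wpM2l; first exact: exprn_ge0.
  have -> : P%:R^-1 - P.+1%:R^-1 = (P%:R * P.+1%:R)^-1 :> R.
    rewrite -natr1; field; apply/andP; split; apply/eqP; lra.
  rewrite expr2 lef_pV2 ?posrE ?mulr_gt0 //.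
  by apply: ler_wpM2r => //; rewrite ler_nat.
rewrite lerXn2r ?nnegrE ?divr_ge0 //.
apply: ler_wpM2l => //; rewrite lef_pV2 ?posrE // ler_nat.
by rewrite /P addSn ltnS ltnS leq_addr.
Qed.

(** The truncation is sent to infinity after dropping the negative telescoping term. The bound
    depends on [y] only through [c]. *)
Lemma tailn_bound n j c y F : (forall k, (1 <= k)%N -> cabs (y k) <= c) ->
  series_to (fun k => wt j k * y k) F ->
  cabs (tailn n j F y - y n.+1) <= c * (n.+1%:R * ratio n ^+ j).
Proof.
move=> hy /series_toE hF.
apply: (@clim_bound _ (fun i =>
   tailn n j (psum (fun k => wt j k * y k) (n.+1 + i)) y - y n.+1)); last first.
  apply: climB; last exact: clim_cst.
  apply: climMl; apply: climB; last exact: clim_cst.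
  by under eq_fun do rewrite addnC; apply/clim_shift.
move=> i; apply: le_trans (tailn_psum_bound n j i hy) _.
have c0 : 0 <= c by apply: le_trans (hy 1%N _); rewrite ?cabs_ge0.
apply: ler_wpM2l => //.
have q0 : 0 <= ratio n ^+ j by apply: exprn_ge0; case/andP: (ratio_itv n).
rewrite -mulrA mulrCA [leRHS]mulrC; apply: ler_wpM2l => //.
rewrite mulrBr expr2 mulfK ?pnatr_eq0 //.
by rewrite gerBl // mulr_ge0 // ?invr_ge0.
Qed.

Lemma tail_null n (c : R) : 0 <= c -> null_seq (fun j => c * (n.+1%:R * ratio n ^+ j)).
Proof.
move=> c0; apply: null_seqMl => //; apply: null_seqMl => //.
exact/null_seq_geometric/ratio_itv.
Qed.

End DirichletTail.

(** * The symbols belong to the space *)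

Section SymbolsInSpace.
Variables (R : realType) (X : Type) (K : X -> X -> R[i]) (H : RKHS K).
Local Notation C := R[i].
Local Notation hm := (hmem H).
Local Notation "<< f , g >>" := (hip H f g).
Local Notation wt := (@wt R).
Local Notation tailn := (@tailn R).

(* Here [pt j] stands for the point p + j + 2 with p > rho a fixed integer, and
   [A], [t], [rs] for symbols, matrix and row sums rescaled by powers m^{-p},
   which makes [t] bounded. *)
Variables (pt : nat -> X) (A : nat -> X -> C) (t rs : nat -> nat -> C) (Cb : R).
Hypothesis t_bound : forall m k, (1 <= m)%N -> (1 <= k)%N -> cabs (t m k) <= Cb.
Hypothesis A_bound : forall s, exists2 c : R, 0 <= c &
  forall k, (1 <= k)%N -> cabs (A k s) <= c.
Hypothesis A_series : forall s j, series_to (fun k => wt j k * A k s) (K s (pt j)).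
Hypothesis A_coef : forall i k, (1 <= k)%N ->
  series_to (fun m => wt i m * t m k) (A k (pt i)).
Hypothesis rs_series : forall j m, (1 <= m)%N ->
  series_to (fun k => wt j k * t m k) (rs m j).
Hypothesis rs_coef : forall i j,
  series_to (fun m => wt i m * rs m j) (K (pt i) (pt j)).

(** Only the values at the points [pt i] are constrained; they suffice to recover the
    coefficients. *)
Definition has_coefs (f : X -> C) (y : nat -> C) :=
  (exists2 c : R, 0 <= c & forall k, (1 <= k)%N -> cabs (y k) <= c) /\
  forall i, series_to (fun m => wt i m * y m) (f (pt i)).

(** The induction statement: membership puts the next approximants in the space, and the pairing
    rule computes inner products with them. *)
Definition represents k :=
  hm (A k) /\ forall f y, hm f -> has_coefs f y -> << f, A k >> = y k.

(** Up to the rescaling, the function [B_N] that approximates the symbol of index [n.+1]. *)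
Definition apx n j : X -> C := fun s => tailn n j (K s (pt j)) (A^~ s).

Definition apx_coef n j m : C := tailn n j (rs m j) (t m).

Lemma Cb_ge0 : 0 <= Cb.
Proof. by apply: le_trans (t_bound (leqnn 1) (leqnn 1)); exact: cabs_ge0. Qed.

Lemma A_has_coefs k : (1 <= k)%N -> has_coefs (A k) (t^~ k).
Proof.
by move=> k1; split=> [|i]; [exists Cb => [|m m1]; [exact: Cb_ge0 | exact: t_bound]
  | exact: A_coef].
Qed.

Lemma apx_coef_bound n j m : (1 <= m)%N ->
  cabs (apx_coef n j m - t m n.+1) <= Cb * (n.+1%:R * ratio R n ^+ j).
Proof.
by move=> m1; apply: tailn_bound (rs_series j m1) => k; exact: t_bound.
Qed.

(** Independence of [j] and [m] lets the tail estimate be applied a second time, in the other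
    variable. *)
Lemma apx_coef_le n j m : (1 <= m)%N -> cabs (apx_coef n j m) <= Cb + Cb * n.+1%:R.
Proof.
move=> m1; have := cabsD (apx_coef n j m - t m n.+1) (t m n.+1); rewrite subrK => h.
apply: le_trans h _; rewrite addrC; apply: lerD; first exact: t_bound.
apply: le_trans (apx_coef_bound n j m1) _; apply: ler_wpM2l; first exact: Cb_ge0.
have /andP[q0 q1] := ratio_itv R n.
by rewrite ler_piMr // exprn_ile1 // ltW.
Qed.

(** The kernel function and the finitely many subtracted symbols all expand in the first variable,
    so the tail can be taken coefficientwise. *)
Lemma apx_has_coefs n j : has_coefs (apx n j) (apx_coef n j).
Proof.
split=> [|i].
  exists (Cb + Cb * n.+1%:R) => [|k]; last exact: apx_coef_le.
  by rewrite addr_ge0 ?mulr_ge0 ?Cb_ge0.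
rewrite /apx /tailn.
apply: (@eq_series_to _ (fun m => n.+1%:R ^+ j.+2 *
   (wt i m * rs m j - psum (fun k => wt j k * (wt i m * t m k)) n)))%R.
  move=> m m1; rewrite /apx_coef /tailn [RHS]mulrCA [in RHS]mulrBr -psumMl; congr (_ * (_ - _)).
  by apply: eq_psum => k _; rewrite mulrCA.
apply: series_toMl; apply: series_toB; first exact: rs_coef.
apply: (@series_to_psum _ (fun k m => wt j k * (wt i m * t m k))) => k /andP[k1 _].
by apply: series_toMl; exact: A_coef.
Qed.

Section Step.
Variable n : nat.
Hypothesis IH : forall k, (1 <= k <= n)%N -> represents k.

Lemma apx_mem j : hm (apx n j).
Proof.
apply: hmemZ; apply: hmemB; first exact: hker_mem.
by apply: hmem_psum => k /IH[].
Qed.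

Lemma hip_apx j f y : hm f -> has_coefs f y ->
  << f, apx n j >> = tailn n j (f (pt j)) y.
Proof.
move=> hf hy; have hA k : (1 <= k <= n)%N -> hm (A k) by move=> /IH[].
rewrite /apx /tailn hipZr //; last first.
  by apply: hmemB; [exact: hker_mem | exact: hmem_psum].
rewrite hipBr ?hip_psumr ?hrepro //; [|exact: hker_mem|exact: hmem_psum].
rewrite rmorphXn /= conjc_nat; congr (_ * (_ - _)); apply: eq_psum => k kn.
by rewrite conjc_wt (proj2 (IH kn) _ _ hf hy).
Qed.

(** Two successive tails: the one at [j] extracts [apx_coef n i n.+1], and the one at [i] inside it
    extracts the diagonal entry of [t]. *)
Lemma apx_gram_bound i j :
  cabs (<< apx n i, apx n j >> - t n.+1 n.+1) <=
  (Cb + Cb * n.+1%:R) * (n.+1%:R * ratio R n ^+ j) + Cb * (n.+1%:R * ratio R n ^+ i).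
Proof.
rewrite (hip_apx _ (apx_mem i) (apx_has_coefs n i)).
set T := tailn _ _ _ _.
rewrite -[T](subrK (apx_coef n i n.+1)) -addrA; apply: le_trans (cabsD _ _) _.
apply: lerD; last exact: apx_coef_bound.
by apply: tailn_bound; [move=> k; exact: apx_coef_le | exact: (apx_has_coefs n i).2].
Qed.

Lemma apx_cauchy (e : R) : 0 < e -> exists N0 : nat, forall i j,
  (N0 <= i)%N -> (N0 <= j)%N -> hsq H (fun x => apx n i x - apx n j x) < e.
Proof.
(* Two tail errors for each of the four Gram entries. *)
move=> e0; have e8 : 0 < e / 8 by lra.
have D0 : 0 <= Cb + Cb * n.+1%:R by rewrite addr_ge0 ?mulr_ge0 ?Cb_ge0.
have [N1 h1] := tail_null n D0 e8; have [N2 h2] := tail_null n Cb_ge0 e8.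
have hg i j : (maxn N1 N2 <= i)%N -> (maxn N1 N2 <= j)%N ->
    cabs (<< apx n i, apx n j >> - t n.+1 n.+1) < e / 4.
  rewrite !geq_max => /andP[_ /h2 hi] /andP[/h1 hj _].
  apply: le_lt_trans (apx_gram_bound i j) _; lra.
exists (maxn N1 N2) => i j hi hj; rewrite /hsq hipBB; try exact: apx_mem.
set T := t n.+1 n.+1 in hg.
have := hg _ _ hi hi; have := hg _ _ hi hj; have := hg _ _ hj hi; have := hg _ _ hj hj.
move: << _, _ >> << _, _ >> << _, _ >> << _, _ >> => a b c d.
have -> : a - b - (c - d) = ((a - T) - (b - T)) - ((c - T) - (d - T)) by ring.
have := cabsB ((a - T) - (b - T)) ((c - T) - (d - T)).
have := cabsB (a - T) (b - T); have := cabsB (c - T) (d - T); lra.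
Qed.

(** The norm limit of the approximants is also their pointwise limit, which the tail estimate
    identifies as [A n.+1]; inner products pass to the same limit. *)
Lemma represents_step : represents n.+1.
Proof.
have [g hg lg] := hcauchy_cvg apx_mem apx_cauchy.
have gA : g = A n.+1.
  apply/funext => s; apply: clim_unique (hlim_eval s apx_mem hg lg) _.
  have [c c0 hc] := A_bound s.
  apply: null_seq_le (tail_null n c0) => j.
  exact: (tailn_bound n hc (A_series s j)).
rewrite /represents -gA; split=> // f y hf hy.
apply: clim_unique (hlim_hipr apx_mem hg hf lg) _.
have [[c c0 hc] hs] := hy.
apply: null_seq_le (tail_null n c0) => j; rewrite (hip_apx j hf hy).
exact: tailn_bound hc (hs j).
Qed.

End Step.

Lemma symbol_represents k : (1 <= k)%N -> represents k.
Proof.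
elim/ltn_ind: k => -[|n] // IH _; apply: represents_step => k /andP[k1 kn].
exact: IH.
Qed.

Lemma symbol_mem k : (1 <= k)%N -> hm (A k).
Proof. by move=> /symbol_represents[]. Qed.

(** [A l] has coefficients [t^~ l], so the pairing rule of [A k] applies to it. *)
Lemma symbol_gram l k : (1 <= l)%N -> (1 <= k)%N -> << A l, A k >> = t k l.
Proof.
move=> l1 k1; have [_ h] := symbol_represents k1.
exact: h (symbol_mem l1) (A_has_coefs l1).
Qed.

End SymbolsInSpace.

(** * Dirichlet series kernels *)

Section Npow.
Variable R : realType.
Local Notation C := R[i].

Lemma npow_conjc k (s : C) : npow k (conjc s) = conjc (npow k s).
Proof. by case: s => x y; rewrite /npow /= [- y * _]mulNr cosN sinN mulrN. Qed.

Lemma npow_nat k N : (1 <= k)%N -> npow k (N%:R%:C : C) = k%:R ^- N.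
Proof.
move=> k1; rewrite /npow /= mul0r cos0 sin0 mulr1 mulr0 oppr0.
rewrite mulNr expRN expRM_natl lnK ?posrE ?ltr0n //.
by rewrite -[Complex _ _]/(_%:C) fmorphV rmorphXn rmorph_nat.
Qed.

End Npow.

(** * Boundedness of the terms of a regularly convergent double series *)

Section RegularConvergence.
Variable R : realType.
Local Notation C := R[i].

Lemma uniform_bound (P : nat -> R -> Prop) :
  (forall m b b', b <= b' -> P m b -> P m b') -> (forall m, exists b, P m b) ->
  forall N, exists2 b, 0 <= b & forall m, (m <= N)%N -> P m b.
Proof.
move=> mono hP; elim=> [|N [b b0 hb]].
  have [b hb] := hP 0%N; exists `|b| => // m; rewrite leqn0 => /eqP ->.
  exact: mono (ler_norm b) hb.
have [b' hb'] := hP N.+1; exists (b + `|b'|) => [|m]; first by rewrite addr_ge0.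
rewrite leq_eqVlt ltnS => /orP[/eqP ->|/hb h].
  by apply: mono hb'; apply: le_trans (ler_norm b') _; rewrite lerDr.
by apply: mono h; rewrite lerDl.
Qed.

(** The double limit controls only terms with both indices large. The finitely many remaining rows
    and columns are bounded because each is a convergent series. *)
Lemma reg_cvg_terms_bounded (a : nat -> nat -> C) (s u : C) : reg_cvg a s u ->
  exists b : R, forall m n, (1 <= m)%N -> (1 <= n)%N ->
    cabs (a m n * npow m s * npow n u) <= b.
Proof.
move=> [[L hL] hcol hrow]; set c := fun m n => _ in hL.
have hrowb m : exists b : R, (1 <= m)%N -> forall n, (1 <= n)%N -> cabs (c m n) <= b.
  case: (posnP m) => [->|m1]; first by exists 0.
  have [S hS] := hrow m m1.
  have [b _ hb] := series_to_terms_bounded (series_toMl (npow m s) hS).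
  by exists b => _ n /hb; rewrite mulrA [npow m s * _]mulrC.
have hcolb n : exists b : R, (1 <= n)%N -> forall m, (1 <= m)%N -> cabs (c m n) <= b.
  case: (posnP n) => [->|n1]; first by exists 0.
  have [S hS] := hcol n n1.
  have [b _ hb] := series_to_terms_bounded (series_toMl (npow n u) hS).
  by exists b => _ m /hb; rewrite mulrC.
have [N0 hN0] := hL _ ltr01.
have hD M N : (N0 <= M)%N -> (N0 <= N)%N -> cabs (dpsum c M N - L) < 1.
  by move=> /hN0 h /h; rewrite cabsE ltcR.
have [b1 b10 hb1] := uniform_bound (fun m b b' hb h m1 n n1 => le_trans (h m1 n n1) hb) hrowb N0.
have [b2 b20 hb2] := uniform_bound (fun m b b' hb h m1 n n1 => le_trans (h m1 n n1) hb) hcolb N0.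
exists (b1 + b2 + 4) => m n m1 n1; rewrite -/(c m n).
have [hm|hm] := leqP m N0; first by have := hb1 _ hm m1 n n1; lra.
have [hn|hn] := leqP n N0; first by have := hb2 _ hn n1 m m1; lra.
case: m n hm hn {m1 n1} => // m [] // n; rewrite !ltnS => hm hn.
(* A term is a mixed second difference of four rectangular sums, each within 1 of [L]; hence the 4
   in the bound. *)
have -> : c m.+1 n.+1 = ((dpsum c m.+1 n.+1 - L) - (dpsum c m n.+1 - L)) -
    ((dpsum c m.+1 n - L) - (dpsum c m n - L)).
  by rewrite !dpsumE !psumS; ring.
set x11 := dpsum c m.+1 n.+1 - L; set x01 := dpsum c m n.+1 - L.
set x10 := dpsum c m.+1 n - L; set x00 := dpsum c m n - L.
have := cabsB (x11 - x01) (x10 - x00); have := cabsB x11 x01; have := cabsB x10 x00.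
have := hD _ _ (leqW hm) (leqW hn); have := hD _ _ hm (leqW hn).
have := hD _ _ (leqW hm) hn; have := hD _ _ hm hn.
rewrite -/x11 -/x01 -/x10 -/x00; lra.
Qed.

Lemma symbP (a : nat -> nat -> C) n s : series_cvg (fun m => a m n * npow m s) ->
  series_to (fun m => a m n * npow m s) (symb a n s).
Proof. by move=> hs; rewrite /symb; case: xgetP => // /(_ _) h; case: hs => L /h. Qed.

End RegularConvergence.

(** * Application to Dirichlet series kernels, and the three claims *)

Section DirichletSeriesKernel.
Variables (R : realType) (rho : R) (a : nat -> nat -> R[i]).
Variable K : Hplane rho -> Hplane rho -> R[i].
Hypotheses (hDS : is_DS_kernel rho a) (hK : is_kernel_of a K).
Local Notation C := R[i].

Definition conjH (u : Hplane rho) : Hplane rho.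
Proof. by exists (conjc (val u)); case: u => -[]. Defined.

Lemma Asym_series n (s : Hplane rho) : (1 <= n)%N ->
  series_to (fun m => a m n * npow m (val s)) (Asym a n s).
Proof. by move=> n1; apply: symbP; have [_ h _] := hDS s s; exact: h. Qed.

Definition row_sum m (u : Hplane rho) : C := symb (fun n m => a m n) m (val u).

Lemma row_sum_series m (u : Hplane rho) : (1 <= m)%N ->
  series_to (fun n => a m n * npow n (val u)) (row_sum m u).
Proof.
move=> m1; apply: (@symbP _ (fun n m => a m n)).
by have [_ _ h] := hDS u u; exact: h.
Qed.

Lemma kernel_symbol_series (s u : Hplane rho) :
  series_to (fun n => Asym a n s * npow n (conjc (val u))) (K s u).
Proof.
apply: dseries_to_iterated (dseries_to_tr (hK s u)) _ => n n1 /=.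
rewrite mulrC; apply: eq_series_to (series_toMl _ (Asym_series s n1)) => m _.
by rewrite mulrC.
Qed.

Lemma kernel_row_series (s u : Hplane rho) :
  series_to (fun m => row_sum m (conjH u) * npow m (val s)) (K s u).
Proof.
apply: dseries_to_iterated (hK s u) _ => m m1 /=.
rewrite mulrC; apply: eq_series_to (series_toMl _ (row_sum_series (conjH u) m1)) => n _.
by rewrite mulrCA mulrA.
Qed.

Variable H : RKHS K.
Local Notation "<< f , g >>" := (hip H f g).

Lemma Asym_mem_gram :
  (forall n, (1 <= n)%N -> hmem H (Asym a n)) /\
  (forall l k, (1 <= l)%N -> (1 <= k)%N -> << Asym a l, Asym a k >> = a k l).
Proof.
pose p := Num.bound `|rho|; pose P : C := p%:R%:C.
have rhop : rho < p%:R by apply: le_lt_trans (ler_norm _) (archi_boundP _).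
have ptP j : rho < complex.Re ((p + j)%:R%:C : C).
  by apply: lt_le_trans rhop _; rewrite ler_nat leq_addr.
pose pt0 j : Hplane rho :=
  exist (fun s : C => rho < complex.Re s) (p + j)%:R%:C (ptP j); pose pt j := pt0 j.+2.
have conj_pt j : conjH (pt0 j) = pt0 j by apply: val_inj; exact: conjc_real.
have conj_val j : conjc (val (pt0 j)) = val (pt0 j) by exact: conjc_real.
have npow_pt0 k j : (1 <= k)%N -> npow k (val (pt0 j)) = npow k P * k%:R ^- j.
  by move=> k1; rewrite /= !npow_nat // exprD invfM.
have npow_pt k j : (1 <= k)%N -> npow k (val (pt j)) = npow k P * wt R j k.
  by move=> k1; exact: npow_pt0.
(* Moving [k^(-p)] from the power [k^(-(p+j+2))] into the coefficients leaves exactly the weight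
   [wt R j k]. *)
pose A k (s : Hplane rho) : C := npow k P * Asym a k s.
pose t m k : C := a m k * npow m P * npow k P.
pose rs m j : C := npow m P * row_sum m (pt j).
(* Regular convergence at [(p, p)] bounds the rescaled matrix [t]. *)
have [b hb] := reg_cvg_terms_bounded (hDS (pt0 0%N) (pt0 0%N)).
have t_bound m k : (1 <= m)%N -> (1 <= k)%N -> cabs (t m k) <= b.
  by move=> m1 k1; have := hb m k m1 k1; rewrite !npow_pt0 // expr0 invr1 !mulr1.
have A_bound s : exists2 c : R, 0 <= c & forall k, (1 <= k)%N -> cabs (A k s) <= c.
  have [c c0 hc] := series_to_terms_bounded (kernel_symbol_series s (pt0 0%N)).
  exists c => // k k1; have := hc k k1.
  by rewrite conj_val npow_pt0 // expr0 invr1 mulr1 mulrC.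
have A_series s j : series_to (fun k => wt R j k * A k s) (K s (pt j)).
  apply: eq_series_to (kernel_symbol_series s (pt j)) => k k1.
  by rewrite conj_val npow_pt // /A; ring.
have A_coef i k : (1 <= k)%N -> series_to (fun m => wt R i m * t m k) (A k (pt i)).
  move=> k1; apply: eq_series_to (series_toMl (npow k P) (Asym_series (pt i) k1)) => m m1.
  by rewrite npow_pt // /t; ring.
have rs_series j m : (1 <= m)%N -> series_to (fun k => wt R j k * t m k) (rs m j).
  move=> m1; apply: eq_series_to (series_toMl (npow m P) (row_sum_series (pt j) m1)) => k k1.
  by rewrite npow_pt // /t; ring.
have rs_coef i j : series_to (fun m => wt R i m * rs m j) (K (pt i) (pt j)).
  apply: eq_series_to (kernel_row_series (pt i) (pt j)) => m m1.
  by rewrite conj_pt npow_pt // /rs; ring.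
have npow_neq0 k : (1 <= k)%N -> npow k P != 0.
  by move=> k1; rewrite npow_nat // invr_neq0 // expf_neq0 // pnatr_eq0 -lt0n.
have npow_real k : conjc (npow k P) = npow k P by rewrite -npow_conjc conjc_real.
have Amem k : (1 <= k)%N -> hmem H (Asym a k).
  move=> k1; have := hmemZ (npow k P)^-1
    (symbol_mem H t_bound A_bound A_series A_coef rs_series rs_coef k1).
  by congr (hmem H _); apply/funext => s; rewrite /A mulKf ?npow_neq0.
split=> // l k l1 k1.
have := symbol_gram H t_bound A_bound A_series A_coef rs_series rs_coef l1 k1.
rewrite /A hipZl ?hipZr ?npow_real; try exact: Amem; last by apply: hmemZ; exact: Amem.
(* The rescaling factors are real and nonzero, so they cancel from the Gram identity. *)
move=> h; have nz : npow l P * npow k P != 0 by rewrite mulf_neq0 // npow_neq0.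
by apply: (mulfI nz); rewrite -mulrA h /t; ring.
Qed.

Definition kernel_psum (s : Hplane rho) N : Hplane rho -> C :=
  fun x => psum (fun n => npow n (conjc (val s)) * Asym a n x) N.

Lemma kernel_psum_mem s N : hmem H (kernel_psum s N).
Proof. by apply: hmem_psum => k /andP[k1 _]; exact: (Asym_mem_gram.1 k k1). Qed.

(** All four terms of the expanded squared distance tend to [K s s], so they cancel in the limit. *)
Lemma kernel_psum_lim s : hlim H (kernel_psum s) (fun x => K x s).
Proof.
have [Amem Agram] := Asym_mem_gram.
have Amem' N k : (1 <= k <= N)%N -> hmem H (Asym a k) by move=> /andP[/Amem].
have hs := hker_mem H s; have hP := kernel_psum_mem s.
have Ks : << fun x => K x s, fun x => K x s >> = K s s by rewrite hrepro.
have lPK : clim (fun N => << kernel_psum s N, fun x => K x s >>) (K s s).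
  under eq_fun do rewrite hrepro //.
  apply/series_toE; apply: eq_series_to (kernel_symbol_series s s) => n _.
  by rewrite mulrC.
have lKP : clim (fun N => << fun x => K x s, kernel_psum s N >>) (K s s).
  under eq_fun do rewrite (hipC (hP _) hs).
  by rewrite (kernel_hermitian H); exact: climJ.
(* The Gram matrix turns this inner product into the [N] by [N] square partial sum of the double
   series at [(s, s)]; no absolute convergence is involved. *)
have lPP : clim (fun N => << kernel_psum s N, kernel_psum s N >>) (K s s).
  move=> e e0; have [N0 hN] := hK s s e0; exists N0 => N hN'.
  have := hN N N hN' hN'; rewrite cabsE ltcR; congr (cabs (_ - _) < e).
  rewrite dpsum_tr dpsumE {1}/kernel_psum hip_psuml //; last exact: Amem'.
  apply: eq_psum => n /andP[n1 _]; rewrite hip_psumr //; [|exact: Amem'|exact: Amem].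
  rewrite -psumMl; apply: eq_psum => m /andP[m1 _].
  by rewrite Agram // !npow_conjc conjcK; ring.
have := climB (climB lPP lPK) (climB lKP (clim_cst (K s s))).
rewrite subrr; apply: null_seq_le => N.
by rewrite subr0 /hsq hipBB // Ks.
Qed.

Lemma symbol_expansion f (s : Hplane rho) : hmem H f ->
  series_to (fun n => << f, Asym a n >> * npow n (val s)) (f s).
Proof.
move=> hf; have := hlim_hipr (kernel_psum_mem s) (hker_mem H s) hf (@kernel_psum_lim s).
rewrite hrepro // => h; apply/series_toE; move: h; congr (clim _ _).
apply/funext => N; rewrite hip_psumr //.
  by apply: eq_psum => n _; rewrite npow_conjc conjcK mulrC.
by move=> k /andP[k1 _]; exact: (Asym_mem_gram.1 k k1).
Qed.

(** Zero padding brings two linear combinations of different lengths to a common length, so that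
    they can be added. *)
Lemma psum_pad (c y : nat -> C) N M : (N <= M)%N ->
  psum (fun k => (if (k <= N)%N then c k else 0) * y k) M = psum (fun k => c k * y k) N.
Proof.
move=> /subnKC <-; elim: (M - N)%N => [|i IH].
  by rewrite addn0; apply: eq_psum => k /andP[_ ->].
by rewrite addnS psumS IH ifN ?mul0r ?addr0 // -ltnNge ltnS leq_addr.
Qed.

Lemma symbols_total : total_in H (Asym a).
Proof.
have [Amem _] := Asym_mem_gram; split=> // f hf e e0.
pose V := [set g : Hplane rho -> C | exists (N : nat) (c : nat -> C),
  g = fun x => psum (fun n => c n * Asym a n x) N]%classic.
have Vm g : V g -> hmem H g.
  by move=> [N [c ->]]; apply: hmem_psum => k /andP[/Amem].
have [||g h [N [c ->]] [M [d ->]]|z g [N [c ->]]|h hh h0||g [N [c ->]] hg] :=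
  @dense_of_orthogonal_trivial _ _ _ H V _ _ _ _ _ f (e ^+ 2) hf.
- exact: Vm.
- by exists 0%N, (fun=> 0); apply/funext => x; rewrite psum0.
- exists (maxn N M), (fun k => (if (k <= N)%N then c k else 0) +
                               (if (k <= M)%N then d k else 0)).
  apply/funext => x.
  rewrite -(psum_pad c _ (leq_maxl N M)) -(psum_pad d _ (leq_maxr N M)) -psumD.
  by apply: eq_psum => k _; rewrite mulrDl.
- exists N, (fun k => z * c k); apply/funext => x; rewrite -psumMl.
  by apply: eq_psum => k _; rewrite mulrA.
(* [h s] is the limit of the pairings of [h] with [kernel_psum s N], which lie in [V]. *)
- apply/funext => s; rewrite -(hrepro s hh).
  have := hlim_hipr (kernel_psum_mem s) (hker_mem H s) hh (@kernel_psum_lim s).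
  have hP0 N : << h, kernel_psum s N >> = 0.
    by apply: h0; exists N, (fun n => npow n (conjc (val s))).
  move=> hl; apply: clim_unique hl _.
  by under eq_fun do rewrite hP0; exact: clim_cst.
- exact: exprn_gt0.
- exists N, c; rewrite /hnorm sqrtC_lt //; apply: hip_ge0; apply: hmemB => //.
  by apply: Vm; exists N, c.
Qed.

End DirichletSeriesKernel.

Theorem theorem2p9 (R : realType) (rho : R) (a : nat -> nat -> R[i])
    (K : Hplane rho -> Hplane rho -> R[i])
    (hDS : is_DS_kernel rho a) (hK : is_kernel_of a K) (hpsd : psd_kernel K)
    (H : RKHS K) :
  [/\ (forall s u : Hplane rho,
         series_to (fun n => Asym a n s * npow n (conjc (val u))) (K s u)),
      (forall f, hmem H f -> forall s : Hplane rho,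
         series_to (fun n => hip H f (Asym a n) * npow n (val s)) (f s))
    & total_in H (Asym a)].
Proof.
split.
- exact: kernel_symbol_series.
- by move=> f hf s; exact: symbol_expansion.
- exact: symbols_total.
Qed.
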